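(* Let $(M,\mathscr{F})$ be a second countable subcartesian differential space of bounded (i.e. finite) structural dimension. Then for any derivation $v\colon\mathscr{F}\to\mathscr{F}$ and for any point $p\in M$ there is a unique maximal integral curve $\gamma_p$ of $v$ with $\gamma_p(0)=p$.
   Context: **Differential spaces.** A differential space (in the sense of Sikorski) is a pair $(M,\mathscr{F})$, where $M$ is a topological space and $\mathscr{F}$ is a nonempty set of real-valued functions on $M$ (the differential structure) such that: (1) the topology of $M$ is the smallest topology making every function in $\mathscr{F}$ continuous; (2) for every integer $m\ge 0$, every $g\in C^\infty(\mathbb{R}^m)$ and all $f_1,\dots,f_m\in\mathscr{F}$, the composite $g\circ(f_1,\dots,f_m)$ is in $\mathscr{F}$; (3) if $g\colon M\to\mathbb{R}$ is a function such that every $p\in M$ has a neighborhood $U$ and a function $a\in\mathscr{F}$ with $g|_U=a|_U$, then $g\in\mathscr{F}$. A map $\varphi\colon (M,\mathscr{F}_M)\to(N,\mathscr{F}_N)$ of differential spaces is smooth if $f\circ\varphi\in\mathscr{F}_M$ for all $f\in\mathscr{F}_N$. It is a diffeomorphism if it is smooth and invertible with smooth inverse. The differential structure $\langle A\rangle$ generated by a set $A$ of real-valued functions on a set is the smallest differential structure containing $A$ (with the corresponding initial topology). For a subset $N\subseteq M$ of a differential space $(M,\mathscr{F})$, the subspace (induced) differential structure on $N$ is $\mathscr{F}_N=\langle \mathscr{F}|_N\rangle$, where $\mathscr{F}|_N=\{f|_N: f\in\mathscr{F}\}$. A smooth map of differential spaces is an embedding if it is injective and is a diffeomorphism onto its image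 with the subspace differential structure. **Subcartesian spaces.** A differential space $(M,\mathscr{F})$ is subcartesian if every $p\in M$ has an open neighborhood $U$ and an embedding $(U,\mathscr{F}_U)\to(\mathbb{R}^n,C^\infty(\mathbb{R}^n))$, with $n$ depending on $p$. The structural dimension of a subcartesian space $M$ at a point $x$ is the smallest integer $n_x$ such that a neighborhood of $x$ can be embedded in $\mathbb{R}^{n_x}$; the structural dimension of $M$ is the supremum of the structural dimensions at its points. **Derivations.** A derivation of $\mathscr{F}$ is an $\mathbb{R}$-linear map $v\colon\mathscr{F}\to\mathscr{F}$ with $v(fg)=v(f)g+fv(g)$ for all $f,g\in\mathscr{F}$. For differential structures this is the same as a $C^\infty$-ring derivation, i.e. a map with $v(g\circ(f_1,\dots,f_n))=\sum_i ((\partial_i g)\circ(f_1,\dots,f_n))\,v(f_i)$ for all $n\ge 1$, $g\in C^\infty(\mathbb{R}^n)$, $f_i\in\mathscr{F}$; the two notions are not distinguished. **Integral curves.** An interval is a connected subset of $\mathbb{R}$ (a single point is allowed; intervals need not be open), with the induced differential structure, the smooth functions $C^\infty(J)$. An integral curve of $v$ is either a map $\gamma\colon J\to M$ from a one-point interval, or a smooth map $\gamma\colon (J,C^\infty(J))\to(M,\mathscr{F})$ from an interval $J$ such that $\frac{d}{dx}(f\circ\gamma)=v(f)\circ\gamma$ for all $f\in\mathscr{F}$. All integral curves are assumed to have $0$ in their domain. An integral curve $\gamma\colon I\to M$ of $v$ is maximal if for every integral curve $\tau\colon K\to M$ of $v$ with $\tau(0)=\gamma(0)$ one has $K\subseteq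 I$ and $\gamma|_K=\tau$. *)

(* Defs.v *)
From HB Require Import structures.
From mathcomp Require Import all_boot all_order all_algebra.
From mathcomp Require Import all_classical all_reals all_analysis.

Set Implicit Arguments.
Unset Strict Implicit.
Unset Printing Implicit Defensive.

Import Order.TTheory GRing.Theory Num.Theory.
Import numFieldNormedType.Exports.

Local Open Scope classical_set_scope.
Local Open Scope ring_scope.

Section smooth_functions.
Context {R : realType} {V : normedModType R}.

(* Coordinate-free C^k, used only for the finite-dimensional spaces V = R and
   V = R^n (where the directional derivatives determine the differential). *)
Fixpoint Ck (k : nat) (g : V -> R) : Prop :=
  if k is k'.+1 then
    (forall x, differentiable g x) /\ (forall u : V, Ck k' (fun x => 'D_u g x))
  else continuous g.

Definition Cinfty : set (V -> R) := [set g | forall k, Ck k g].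

End smooth_functions.

Section differential_structures.
Context {R : realType}.

Definition is_topology {T : Type} (O : set (set T)) : Prop :=
  [/\ O setT,
      (forall A B, O A -> O B -> O (A `&` B)) &
      (forall G : set (set T), G `<=` O -> O (\bigcup_(A in G) A))].

Definition initial_open {T : Type} (F : set (T -> R)) : set (set T) :=
  smallest is_topology
    [set f @^-1` B | f in F & B in [set B : set R | open B]].

(* A differential structure on a bare set T, topologized by the smallest
   topology making every function in F continuous. *)
Record differential_structure {T : Type} (F : set (T -> R)) : Prop := {
  ds_nonempty : F !=set0 ;
  ds_comp : forall (m : nat) (g : 'rV[R]_m -> R) (f : 'I_m -> T -> R),
    Cinfty g -> (forall i, F (f i)) -> F (fun x => g (\row_i f i x)) ;
  ds_local : forall g : T -> R,
    (forall p, exists U, [/\ initial_open F U, U p &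
       exists2 a, F a & forall x, U x -> g x = a x]) -> F g }.

Definition differential_space (M : topologicalType) (F : set (M -> R)) : Prop :=
  (forall A : set M, open A <-> initial_open F A) /\ differential_structure F.

Definition generated {T : Type} (A : set (T -> R)) : set (T -> R) :=
  smallest differential_structure A.

Definition subspace_structure {T : Type} (F : set (T -> R)) (N : set T) :
    set (N -> R) :=
  generated [set (fun x : N => f (\val x)) | f in F].

Arguments subspace_structure {T} F N _.

Definition smooth_map {S T : Type} (F : set (S -> R)) (G : set (T -> R))
    (phi : S -> T) : Prop :=
  forall f, G f -> F (f \o phi).

Definition diffeomorphism {S T : Type} (F : set (S -> R)) (G : set (T -> R))
    (phi : S -> T) : Prop :=
  smooth_map F G phi /\
  exists psi, [/\ cancel phi psi, cancel psi phi & smooth_map G F psi].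

Definition onto_image {S T : Type} (phi : S -> T) : S -> range phi :=
  fun x => exist _ (phi x) (mem_set (imageP phi (I : setT x))).

Definition embedding {S T : Type} (F : set (S -> R)) (G : set (T -> R))
    (phi : S -> T) : Prop :=
  [/\ smooth_map F G phi, injective phi &
      diffeomorphism F (subspace_structure G (range phi)) (onto_image phi)].

End differential_structures.

Arguments subspace_structure {R T} F N _.

Section subcartesian.
Context {R : realType} {M : topologicalType}.
Context (F : set (M -> R)).

Definition embeds_in_Rn (U : set M) (n : nat) : Prop :=
  exists phi : U -> 'rV[R]_n, embedding (subspace_structure F U) Cinfty phi.

Definition subcartesian : Prop :=
  forall p : M, exists U : set M,
    [/\ open U, U p & exists n, embeds_in_Rn U n].

Definition structural_dimension_at (x : M) (n : nat) : Prop :=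
  (exists2 U, nbhs x U & embeds_in_Rn U n) /\
  (forall m, (exists2 U, nbhs x U & embeds_in_Rn U m) -> (n <= m)%N).

Definition structural_dimension : \bar R :=
  ereal_sup [set (n%:R)%:E | n in [set n : nat |
    exists x, structural_dimension_at x n]].

(* A map F -> F is represented by a map on all functions M -> R preserving F;
   its values outside F are irrelevant. *)
Record derivation (v : (M -> R) -> (M -> R)) : Prop := {
  der_in : forall f, F f -> F (v f) ;
  der_linear : forall (a b : R) f g, F f -> F g ->
    v (fun x => a * f x + b * g x) = (fun x => a * v f x + b * v g x) ;
  der_leibniz : forall f g, F f -> F g ->
    v (fun x => f x * g x) = (fun x => v f x * g x + f x * v g x) }.

End subcartesian.

Section integral_curves.
Context {R : realType} {M : topologicalType}.

Record curve : Type := Curve { dom : set R ; path_of :> dom -> M }.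

(* Derivative relative to J, hence one-sided at the endpoints of an interval;
   the limit is taken in the subtype topology of J. *)
Definition has_derivative_in (J : set R) (h : J -> R) (t : J) (l : R) : Prop :=
  (fun s : J => (h s - h t) / (\val s - \val t)) @ t^' --> l.

Context (F : set (M -> R)) (v : (M -> R) -> (M -> R)).

Definition integral_curve (c : curve) : Prop :=
  [/\ connected (dom c), dom c 0 &
      (exists t, dom c = [set t]) \/
      (smooth_map (subspace_structure (@Cinfty R R) (dom c)) F c /\
       forall f, F f -> forall t : dom c,
         has_derivative_in (fun s => f (c s)) t (v f (c t)))].

Definition starts_at (c : curve) (p : M) : Prop :=
  exists2 t : dom c, \val t = 0 & c t = p.

Definition restricts_to (c k : curve) : Prop :=
  dom k `<=` dom c /\
  forall (s : dom c) (t : dom k), \val s = \val t -> c s = k t.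

Definition maximal_integral_curve (c : curve) : Prop :=
  integral_curve c /\
  forall k : curve, integral_curve k ->
    (exists2 p, starts_at c p & starts_at k p) -> restricts_to c k.

End integral_curves.

Arguments curve R M : clear implicits.

(* Main.v *)
From HB Require Import structures.
From mathcomp Require Import all_boot all_order all_algebra.
From mathcomp Require Import all_classical all_reals all_analysis.
From mathcomp Require Import ring lra.
Require Import Defs.

(** The maximal integral curve through [p] is the union of all integral curves
    of [v] that start at [p], a family which contains the curve defined at
    time 0 only. Two things have to be checked.

    The union is a function, that is, two integral curves [c1], [c2] through
    [p] agree on their common domain ([solutions_agree]). Around a point [q],
    an embedding into Euclidean space provides functions [a_1, ..., a_n] of
    the structure that separate the points near [q] and of which every member
    of the structure is locally a Lipschitz function ([local_coordinates]).
    As [v a_i] belongs to the structure, if [c1] and [c2] meet at [q] at some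
    time then the coordinates of [c1] and [c2] satisfy
    [|(a_i c1)' - (a_i c2)'| <= L |a c1 - a c2|] near that time, and
    Gronwall's inequality makes the two curves coincide there. So the set of
    times where the curves coincide is open in the common domain. It is closed
    because the structure separates the points of the whole space
    ([structure_separates]), and the common domain is connected.

    The union is an integral curve ([union_solution]). Near a time [x != 0]
    of its domain it coincides with a single member of the family, including
    when [x] is an end of the domain. At time 0 it may happen that only one
    member continues forward and only another one continues backward
    ([union_locally_covered]). For [f] in the structure, the composite of [f]
    with the union is then glued at 0 from two smooth functions. Both have
    [(v^n f) p] as [n]-th derivative at 0, because the derivative of [f] along
    an integral curve is [v f] ([solution_jets]), so the glued function is
    smooth ([glue_Cinfty]). *)

Set Implicit Arguments.
Unset Strict Implicit.
Unset Printing Implicit Defensive.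

Import Order.TTheory GRing.Theory Num.Theory.
Import numFieldNormedType.Exports.

Local Open Scope ring_scope.
Local Open Scope classical_set_scope.

(** * Smooth functions on the real line *)

Lemma Cinfty_constant_derivative (R : realType) (V : normedModType R) (g : V -> R) :
  (forall x, differentiable g x) ->
  (forall u, exists c, forall x, 'D_u g x = c) -> Cinfty g.
Proof.
have CkC k (c : R) : Ck k (fun _ : V => c).
  elim: k c => [|k IH] c /=; first by move=> x; exact: cvg_cst.
  split=> [x|u]; first exact: differentiable_cst.
  have -> : (fun x => 'D_u (fun _ : V => c) x) = (fun=> 0 : R).
    by apply/funext => x; exact: derive_cst.
  exact: IH.
move=> dg Dg [|k] /=; first by move=> x; exact: differentiable_continuous.
split=> // u; have [c Dc] := Dg u.
have -> : (fun x => 'D_u g x) = (fun=> c) by apply/funext.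
exact: CkC.
Qed.

Lemma derive_scaled (R : realType) (g : R -> R) u x :
  differentiable g x -> 'D_u g x = u * derive1 g x.
Proof.
move=> dg; rewrite deriveE// derive1E deriveE// -[u in LHS]mulr1.
by rewrite -[u * 1]/(u *: (1 : R)) linearZ.
Qed.

(** On the line ['D_u g] is [u] times the derivative, so the iterated derivative
    in direction 1 controls all the directions. *)
Lemma CinftyP (R : realType) (g : R -> R) :
  Cinfty g <-> forall n x, derivable (derive1n n g) x 1.
Proof.
split=> [+ n|dg k].
  elim: n g => [|n IH] g Cg x; first by apply/derivable1_diffP; have [] := Cg 1%N.
  rewrite derive1Sn; apply: IH => k.
  have -> : derive1 g = (fun x => 'D_1 g x) by apply/funext=> y; rewrite derive1E.
  by have [_] := Cg k.+1; apply.
(* The scalar factor makes the induction pass through the directions [u]. *)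
have -> : g = (fun x => 1 * g x) by apply/funext=> y; rewrite mul1r.
elim: k g dg 1 => [|k IH] g dg c /=.
  move=> x; apply: cvgM; first exact: cvg_cst.
  by apply: differentiable_continuous; apply/derivable1_diffP/(dg 0%N).
have dcg x : differentiable (fun x => c * g x) x.
  by apply: differentiableM => //; apply/derivable1_diffP/(dg 0%N).
split=> // u.
have -> : (fun x => 'D_u (fun x => c * g x) x) = (fun x => (u * c) * derive1 g x).
  apply/funext => x; have dgx := dg 0%N x.
  by rewrite derive_scaled // derive1E (deriveZ c dgx) derive1E mulrA.
by apply: IH => n x; rewrite -derive1Sn.
Qed.

Lemma is_derive_affine (R : realType) (a b x u : R) :
  is_derive x u (fun x : R => a + x * b) (u * b).
Proof.
have -> : (fun x : R => a + x * b) = cst a + b *: (@idfun R).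
  by apply/funext => y; rewrite mulrC.
have D := is_deriveD (is_derive_cst a x u) (is_deriveZ b (is_derive_id x u)).
by apply: (@is_derive_eq _ _ _ _ _ _ _ _ D); rewrite add0r [b *: u]mulrC.
Qed.

Lemma Cinfty_affine (R : realType) (a b : R) : Cinfty (fun x : R => a + x * b).
Proof.
apply: Cinfty_constant_derivative => [x|u].
  by apply/derivable1_diffP; have [] := is_derive_affine a b x 1.
by exists (u * b) => x; have [_ ->] := is_derive_affine a b x u.
Qed.

Lemma derive1_affine (R : realType) (a b x : R) :
  derive1 (fun x : R => a + x * b) x = b.
Proof.
by rewrite derive1E; have [_ ->] := is_derive_affine a b x 1; rewrite mul1r.
Qed.

Definition glue (R : realType) (A B : R -> R) (x : R) : R :=
  if 0 <= x then A x else B x.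

Lemma is_derive_glue (R : realType) (A B : R -> R) :
  (forall x, derivable A x 1) -> (forall x, derivable B x 1) ->
  A 0 = B 0 -> derive1 A 0 = derive1 B 0 ->
  forall x : R, is_derive x (1 : R) (glue A B) (glue (derive1 A) (derive1 B) x).
Proof.
move=> dA dB AB AB' x.
have [x_gt0|x_lt0|<-] := ltgtP 0 x.
- apply: (@near_eq_is_derive _ _ _ A).
    by near=> y; rewrite /glue ltW//; near: y; exact: lt_nbhsr.
  by rewrite /glue ltW// derive1E; exact: DeriveDef.
- apply: (@near_eq_is_derive _ _ _ B).
    by near=> y; rewrite /glue leNgt; have -> : y < 0 by near: y; exact: lt_nbhsl.
  by rewrite /glue leNgt x_lt0 /= derive1E; exact: DeriveDef.
rewrite {2}/glue lexx.
suff H : h^-1 *: (glue A B (h *: 1 + 0) - glue A B 0) @[h --> (0:R)^'] --> derive1 A 0.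
  apply: DeriveDef; first by apply: cvgP; exact: H.
  exact: (cvg_lim _ H).
apply: (@cvg_at_right_left_dnbhs _ R^o).
- apply: (@cvg_trans _ ((fun h => h^-1 *: (A (h *: 1 + 0) - A 0)) @ (0:R)^'+)).
    apply: near_eq_cvg; near=> h.
    have h0 : 0 < h by [].
    by rewrite /glue lexx addr0 /GRing.scale/= mulr1 ltW.
  rewrite derive1E; apply: cvg_dnbhs_at_right; exact: (dA 0).
- apply: (@cvg_trans _ ((fun h => h^-1 *: (B (h *: 1 + 0) - B 0)) @ (0:R)^'-)).
    apply: near_eq_cvg; near=> h.
    have h0 : h < 0 by [].
    by rewrite /glue lexx addr0 /GRing.scale/= mulr1 leNgt h0 AB.
  rewrite AB' derive1E; apply: cvg_dnbhs_at_left; exact: (dB 0).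
Unshelve. all: by end_near. Qed.

(** By [is_derive_glue] at every order, the [n]-th derivative of the glued
    function is the glueing of the [n]-th derivatives. *)
Lemma glue_Cinfty (R : realType) (A B : R -> R) : Cinfty A -> Cinfty B ->
  (forall n, derive1n n A 0 = derive1n n B 0) -> Cinfty (glue A B).
Proof.
move=> /CinftyP dA /CinftyP dB AB; apply/CinftyP => n.
have D k (x : R) : is_derive x (1 : R) (glue (derive1n k A) (derive1n k B))
    (glue (derive1n k.+1 A) (derive1n k.+1 B) x).
  by rewrite !derive1nS; apply: is_derive_glue => //; rewrite -!derive1nS.
have -> : derive1n n (glue A B) = glue (derive1n n A) (derive1n n B).
  elim: n => [//|n IH]; rewrite derive1nS IH; apply/funext => x.
  by rewrite derive1E derive_val.
by move=> x; have [] := D n x.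
Qed.

Lemma Cinfty_coord (R : realType) n (i : 'I_n) :
  Cinfty (fun y : 'rV[R]_n => y ord0 i).
Proof.
pose c : {linear 'rV[R]_n -> R} :=
  HB.pack (fun y : 'rV[R]_n => y ord0 i)
    (GRing.isLinear.Build _ _ _ _ (fun y : 'rV[R]_n => y ord0 i)
       (fun a u w => etrans (mxE _ _ _ _)
          (congr1 (fun z => z + w ord0 i) (mxE _ _ _ _)))).
have cc : continuous c by exact: coord_continuous.
apply: (@Cinfty_constant_derivative _ _ c) => [x|u].
  exact: linear_differentiable.
by exists (c u) => x; rewrite deriveE ?diff_lin//; exact: linear_differentiable.
Qed.

(** * Composition of smooth functions *)

Section smooth_composites.
Context {R : realType}.

Lemma Cinfty_continuous (V : normedModType R) (g : V -> R) : Cinfty g -> continuous g.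
Proof. by move=> Cg; exact: (Cg 0%N). Qed.

(** A coinduction principle: it reduces smoothness to finding a class of
    functions that is stable under differentiation. *)
Lemma Cinfty_coind (S : set (R -> R)) :
  (forall h, S h -> (forall x, derivable h x 1) /\ S (derive1 h)) -> S `<=` Cinfty.
Proof.
move=> SD h Sh; apply/CinftyP => n.
suff : S (derive1n n h) by move=> /SD[].
by elim: n => // n; rewrite derive1nS => /SD[].
Qed.

Lemma Cinfty_derive1 (f : R -> R) : Cinfty f -> Cinfty (derive1 f).
Proof. by move=> /CinftyP df; apply/CinftyP => n x; rewrite -derive1Sn. Qed.

Lemma Cinfty_derivable (f : R -> R) : Cinfty f -> forall x, derivable f x 1.
Proof. by move=> /CinftyP /(_ 0%N). Qed.

Lemma Cinfty_derive (V : normedModType R) (g : V -> R) u :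
  Cinfty g -> Cinfty (fun x => 'D_u g x).
Proof. by move=> Cg k; have [_] := Cg k.+1; apply. Qed.

Lemma derive_coord n (g : 'rV[R]_n -> R) (u x : 'rV[R]_n) : differentiable g x ->
  'D_u g x = \sum_i u ord0 i * 'D_('e_i) g x.
Proof.
move=> dg; rewrite deriveE// [u in LHS]row_sum_delta linear_sum.
by apply: eq_bigr => i _; rewrite linearZ/= deriveE.
Qed.

Lemma is_derive_comp_row n (g : 'rV[R]_n -> R) (f : 'I_n -> R -> R) (x : R) :
  (forall y, differentiable g y) -> (forall i, derivable (f i) x 1) ->
  is_derive x (1 : R) (fun t => g (\row_i f i t))
    (\sum_i derive1 (f i) x * 'D_('e_i) g (\row_i f i x)).
Proof.
move=> dg df.
pose r (t : R) : 'rV[R]_n := \row_i f i t.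
have dr : derivable r x 1.
  apply/derivable_mxP => i j; rewrite (_ : (fun _ => _) = f j) //.
  by apply/funext => t; rewrite mxE.
have Dr : 'D_1 r x = \row_i derive1 (f i) x.
  rewrite derive_mx//; apply/rowP => j; rewrite !mxE derive1E.
  have -> : (fun t => r t ord0 j) = f j by apply/funext => t; rewrite mxE.
  by [].
have dfr : differentiable r x by apply/derivable1_diffP.
have dgr : differentiable (g \o r) x by exact: differentiable_comp.
have -> : (fun t => g (\row_i f i t)) = g \o r by [].
apply: DeriveDef; first by apply/derivable1_diffP.
rewrite deriveE// diff_comp//= -deriveE// -deriveE// derive_coord//.
by apply: eq_bigr => i _; rewrite Dr mxE.
Qed.

(** The derivative of [x |-> g (f_1 x, ..., f_n x)] is a sum of products of
    such composites with smooth functions. This inductive class is the least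
    one that makes the chain rule stay inside it, and serves as the invariant
    for [Cinfty_coind]. *)
Inductive smooth_expr n (f : 'I_n -> R -> R) : (R -> R) -> Prop :=
| Smooth_expr_comp g : Cinfty g -> smooth_expr f (fun x => g (\row_i f i x))
| Smooth_expr_fun h : Cinfty h -> smooth_expr f h
| Smooth_expr_add h k : smooth_expr f h -> smooth_expr f k ->
    smooth_expr f (fun x => h x + k x)
| Smooth_expr_mul h k : smooth_expr f h -> smooth_expr f k ->
    smooth_expr f (fun x => h x * k x).

Lemma Cinfty_comp_row n (g : 'rV[R]_n -> R) (f : 'I_n -> R -> R) :
  Cinfty g -> (forall i, Cinfty (f i)) -> Cinfty (fun x : R => g (\row_i f i x)).
Proof.
move=> Cg Cf; apply: (@Cinfty_coind (smooth_expr f)); last exact: Smooth_expr_comp.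
move=> e.
elim=> {e} [{Cg}{}g Cg|h Ch|h k _ [dh Sh] _ [dk Sk]|h k Sh0 [dh Sh] Sk0 [dk Sk]].
- have D (x : R) : is_derive x (1 : R) (fun t => g (\row_i f i t))
      (\sum_i derive1 (f i) x * 'D_('e_i) g (\row_i f i x)).
    apply: is_derive_comp_row => [y|i]; first exact: (Cg 1%N).1.
    exact: Cinfty_derivable.
  split=> [x|]; first by have [] := D x.
  have -> : derive1 (fun x => g (\row_i f i x)) =
      (fun x => \sum_i derive1 (f i) x * 'D_('e_i) g (\row_i f i x)).
    by apply/funext => x; rewrite derive1E; have [_ ->] := D x.
  elim: (index_enum _) => [|i s IH].
    under eq_fun do rewrite big_nil.
    apply: Smooth_expr_fun.
    have := Cinfty_affine (0 : R) 0; congr Cinfty; apply/funext => x.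
    by rewrite mulr0 addr0.
  under eq_fun do rewrite big_cons.
  apply: Smooth_expr_add => //; apply: Smooth_expr_mul.
    exact/Smooth_expr_fun/Cinfty_derive1.
  by apply: (@Smooth_expr_comp _ _ (fun y => 'D_('e_i) g y)); exact: Cinfty_derive.
- split=> [x|]; first exact: Cinfty_derivable.
  exact/Smooth_expr_fun/Cinfty_derive1.
- split=> [x|]; first exact: derivableD.
  have -> : derive1 (fun x => h x + k x) = (fun x => derive1 h x + derive1 k x).
    by apply/funext => x; rewrite !derive1E deriveD.
  exact: Smooth_expr_add.
- split=> [x|]; first exact: derivableM.
  have -> : derive1 (fun x => h x * k x) =
      (fun x => h x * derive1 k x + k x * derive1 h x).
    by apply/funext => x; rewrite !derive1E deriveM.
  by apply: Smooth_expr_add; exact: Smooth_expr_mul.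
Qed.

End smooth_composites.

(** * Topologies and structures generated by functions *)

Section generated_structures.
Context {R : realType}.

(** The induction principle for the topology generated by [F]: a property of
    sets that defines a topology and holds for the preimages of open sets under
    members of [F] holds for all the open sets. *)
Lemma initial_open_subset (T : Type) (F : set (T -> R)) (O : set (set T)) :
  is_topology O -> (forall f B, F f -> open B -> O (f @^-1` B)) ->
  initial_open F `<=` O.
Proof.
by move=> topO FO; apply: smallest_sub => // _ [f Ff [B oB] <-]; exact: FO.
Qed.

Lemma is_topology_open (T : topologicalType) : is_topology (@open T).
Proof.
split; [exact: openT | by move=> *; exact: openI | move=> G sG].
by apply: bigcup_open => A /sG.
Qed.

Lemma initial_open_preimage (T : Type) (F : set (T -> R)) f (B : set R) :
  F f -> open B -> initial_open F (f @^-1` B).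
Proof. by move=> Ff oB; apply: sub_gen_smallest; exists f => //; exists B. Qed.

Lemma subspace_structure_restriction (T : Type) (F : set (T -> R)) (N : set T) f :
  F f -> subspace_structure F N (fun x => f (\val x)).
Proof. by move=> Ff; apply: sub_gen_smallest; exists f. Qed.

(** The functions that are locally restrictions of members of [F] form a
    differential structure, so the generated structure contains nothing else.
    They are continuous for the topology of the subtype, which is why the
    neighborhoods in the locality axiom can be taken in that topology. *)
Lemma subspace_structure_local (T : topologicalType) (F : set (T -> R)) (N : set T) h :
  F !=set0 ->
  (forall m (g : 'rV[R]_m -> R) f, Cinfty g -> (forall i, F (f i)) ->
    F (fun x => g (\row_i f i x))) ->
  (forall f, F f -> continuous f) ->
  subspace_structure F N h ->
  forall x : N, exists2 a, F a & \forall y \near x, h y = a (set_val y).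
Proof.
move=> F0 Fcomp Fcont; move: h.
pose G : set (N -> R) := [set h : N -> R | forall x : N,
  exists2 a, F a & \forall y \near x, h y = a (set_val y)].
have Gcont h : G h -> continuous h.
  move=> Gh x; have [a Fa ha] := Gh x.
  have hx : h x = a (set_val x) := nbhs_singleton ha.
  rewrite /continuous_at hx; apply: (@cvg_trans _ ((a \o set_val) @ x)).
    by apply: (@near_eq_cvg _ _ (nbhs x)); near=> y; apply/esym; near: y; exact: ha.
  apply: (@continuous_comp N T R set_val a x); last exact: Fcont.
  exact: initial_continuous.
suff : subspace_structure F N `<=` G by [].
apply: smallest_sub; last by move=> _ [f Ff <-] x; exists f => //; near=> y.
split.
- have [f Ff] := F0; exists (fun x => f (\val x)) => x; exists f => //.
  by near=> y.
- move=> m g f Cg Gf x; pose a i := sval (cid2 (Gf i x)).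
  exists (fun y => g (\row_i a i y)).
    by apply: Fcomp => // i; rewrite /a; case: cid2.
  have : \forall y \near x, forall i, f i y = a i (set_val y).
    apply: (@filter_forall _ _ (fun i y => f i y = a i (set_val y)) (nbhs x)) => i.
    by rewrite /a; case: cid2.
  by apply: filterS => y fa; congr g; apply/rowP => i; rewrite !mxE fa.
- move=> g gloc x; have [U [oU Ux [a Ga ga]]] := gloc x.
  have [b Fb ab] := Ga x; exists b => //.
  have : \forall y \near x, U y.
    apply: open_nbhs_nbhs; split => //; apply: initial_open_subset oU.
      exact: is_topology_open.
    by move=> f B /Gcont /continuousP; apply.
  by apply: filterS2 ab => y ab /ga ->.
Unshelve. all: by end_near. Qed.

Lemma nbhs_set_type (T : topologicalType) (N : set T) (x : N) (P : set N) :
  nbhs x P -> \forall y \near \val x, forall z : N, \val z = y -> P z.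
Proof.
rewrite nbhsE => -[_ [[W oW <-] Wx] WP].
apply: filterS (open_nbhs_nbhs (conj oW Wx)) => y Wy z zy.
by apply: WP => /=; rewrite (_ : set_val z = y).
Qed.

Lemma row_continuous_at (T : topologicalType) n (a : 'I_n -> T -> R) (x : T) :
  (forall i, {for x, continuous (a i)}) ->
  {for x, continuous (fun y => \row_i a i y : 'rV[R]_n)}.
Proof.
move=> ca; apply/cvgrPdist_lt => e e0.
have : \forall y \near x, forall i, `|a i x - a i y| < e.
  by apply: filter_forall => i; by have /cvgrPdist_lt := ca i; apply.
apply: filterS => y ay.
rewrite [ltLHS]/Num.Def.normr/= mx_normrE; apply: bigmax_lt => //= -[i j] _ /=.
by rewrite !mxE.
Qed.

End generated_structures.

(** * Locally Lipschitz functions *)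

Section lipschitz.
Context {R : realType}.

(** The Lipschitz condition is relative to [phi], which plays the role of a
    system of coordinates on [T]. *)
Definition lipschitz_near (T : topologicalType) (W : normedModType R)
    (phi : T -> W) (h : T -> R) (x : T) : Prop :=
  exists2 L : R, 0 <= L & exists2 U, nbhs x U &
    forall y z, U y -> U z -> `|h y - h z| <= L * `|phi y - phi z|.

Lemma norm_coord_le n (u : 'rV[R]_n) i : `|u ord0 i| <= `|u|.
Proof.
rewrite [leRHS]/Num.Def.normr/= mx_normrE.
exact: (le_bigmax _ (fun ij : 'I_1 * 'I_n => `|u ij.1 ij.2|) (ord0, i)).
Qed.

Lemma norm_row_le n (u : 'rV[R]_n) c : 0 <= c ->
  (forall i, `|u ord0 i| <= c) -> `|u| <= c.
Proof.
move=> c0 uc; rewrite [leLHS]/Num.Def.normr/= mx_normrE.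
by apply: bigmax_le => // -[i j] _ /=; rewrite (ord1 i).
Qed.

(** The partial derivatives of [g] are bounded on a ball around [x], and the mean
    value theorem applies along segments since balls are convex. *)
Lemma Cinfty_lipschitz n (g : 'rV[R]_n -> R) x : Cinfty g -> lipschitz_near id g x.
Proof.
move=> Cg.
pose D j y := `|'D_('e_j) g y|.
have dg y : differentiable g y := (Cg 1%N).1 y.
have : \forall y \near x, forall j, D j y < D j x + 1.
  apply: (@filter_forall _ _ (fun j y => D j y < D j x + 1) (nbhs x)) => j.
  have cD : {for x, continuous (fun y => 'D_('e_j) g y)}.
    exact: Cinfty_continuous (Cinfty_derive _ Cg) _.
  have := cvgr_norm_lt _ (cD : _ @ nbhs x --> _); apply.
  by rewrite /D ltrDl.
move=> /nbhs_ballP [e /= e0 xe].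
exists (\sum_j (D j x + 1)).
  by apply: sumr_ge0 => j _; rewrite addr_ge0 // normr_ge0.
exists (ball x e); first exact: nbhsx_ballx.
move=> y z xy xz; pose w := y - z.
have dphi (t : R) :
    is_derive t (1 : R) (fun t : R => g (z + t *: w)) ('D_w g (z + t *: w)).
  have quot : (fun h : R => h^-1 *: (g (h *: w + (z + t *: w)) - g (z + t *: w))) =
      (fun h : R => h^-1 *: (g (z + (h *: (1 : R) + t) *: w) - g (z + t *: w))).
    by apply/funext => h; rewrite [h *: (1 : R)]mulr1 scalerDl addrCA.
  have := diff_derivable (v := w) (dg (z + t *: w)).
  by rewrite /derivable quot => dq; apply: DeriveDef; rewrite // /derive quot.
have cphi : continuous (fun t : R => g (z + t *: w)).
  move=> t; apply: differentiable_continuous; apply/derivable1_diffP.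
  by have [] := dphi t.
have [t] := MVT_segment ler01 (fun t _ => dphi t) (continuous_subspaceT cphi).
rewrite in_itv/= => /andP[t0 t1].
rewrite scale1r scale0r addr0 subr0 mulr1 [z + w]addrC subrK => ->.
rewrite derive_coord// (le_trans (ler_norm_sum _ _ _))// mulrC mulr_sumr.
apply: ler_sum => j _; rewrite normrM ler_pM ?norm_coord_le//.
apply/ltW/xe; move: xy xz; rewrite -ball_normE /ball_ /= => xy xz.
have -> : x - (z + t *: w) = (1 - t) *: (x - z) + t *: (x - y).
  by apply/rowP => i; rewrite !mxE; ring.
rewrite (le_lt_trans (ler_normD _ _))// !normrZ (ger0_norm t0).
rewrite ger0_norm ?subr_ge0//.
apply: (@le_lt_trans _ _ (Num.max `|x - z| `|x - y|)); last by rewrite gt_max xy xz.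
set m := Num.max _ _; have -> : m = (1 - t) * m + t * m by ring.
rewrite lerD// ler_wpM2l ?subr_ge0//.
  by rewrite le_max lexx.
by rewrite le_max lexx orbT.
Qed.

(** Continuous functions that are locally Lipschitz form a differential
    structure: composing with a smooth function of several variables preserves
    the property by [Cinfty_lipschitz]. Hence every function generated by the
    restrictions of smooth functions is locally Lipschitz. *)
Lemma subspace_structure_lipschitz n (N : set 'rV[R]_n) (h : N -> R) :
  subspace_structure Cinfty N h ->
  forall x : N, lipschitz_near set_val h x.
Proof.
move: h.
pose G : set (N -> R) := [set h : N -> R | continuous h /\
  forall x : N, lipschitz_near set_val h x].
suff : subspace_structure Cinfty N `<=` G by move=> sG h /sG[].
apply: smallest_sub.
  split.
  - exists (fun=> 0); split=> [|x]; first exact: (@cst_continuous N R 0).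
    exists 0 => //; exists setT; first exact: filterT.
    by move=> y z _ _; rewrite subrr normr0 mul0r.
  - move=> m g h Cg Gh.
    have crow (x : N) : {for x, continuous (fun y : N => \row_i h i y : 'rV[R]_m)}.
      by apply: row_continuous_at => i; exact: (Gh i).1.
    split=> x.
      apply: (@continuous_comp N _ R (fun y : N => \row_i h i y : 'rV[R]_m) g x) => //.
      exact: Cinfty_continuous.
    have [L L0 [U Ux UL]] := Cinfty_lipschitz (\row_i h i x) Cg.
    pose K i := s2val (cid2 ((Gh i).2 x)).
    have K0 i : 0 <= K i by rewrite /K; case: cid2.
    have KP i : exists2 W, nbhs x W &
      forall y z, W y -> W z -> `|h i y - h i z| <= K i * `|set_val y - set_val z|.
      by rewrite /K; case: cid2.
    pose W i := s2val (cid2 (KP i)).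
    have Wx i : nbhs x (W i) by rewrite /W; case: cid2.
    have WP i y z : W i y -> W i z -> `|h i y - h i z| <= K i * `|set_val y - set_val z|.
      by rewrite /W; case: cid2 => ? ? /=; apply.
    exists (L * \sum_i K i); first by rewrite mulr_ge0// sumr_ge0.
    exists [set y | U (\row_i h i y) /\ forall i, W i y].
      apply: filterI; first exact: crow.
      exact: (@filter_forall _ _ W (nbhs x)).
    move=> y z [Uy Wy] [Uz Wz]; apply: (le_trans (UL _ _ Uy Uz)).
    rewrite -mulrA ler_wpM2l//; apply: norm_row_le => [|i].
      by rewrite mulr_ge0// sumr_ge0.
    rewrite !mxE; apply: (le_trans (WP i _ _ (Wy i) (Wz i))).
    by rewrite ler_wpM2r// (bigD1 i)//= lerDl sumr_ge0.
  - move=> g gloc.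
    have H (x : N) : exists U : set N, nbhs x U /\
        exists2 a, G a & forall y : N, U y -> g y = a y.
      have [U [oU Ux ga]] := gloc x; exists U; split=> //.
      apply: open_nbhs_nbhs; split => //; apply: initial_open_subset oU.
        exact: is_topology_open.
      by move=> f B [/continuousP + _]; apply.
    split=> x; have [U [Ux [a [ca La] ga]]] := H x.
      rewrite /continuous_at (ga _ (nbhs_singleton Ux)).
      apply: (@cvg_trans _ (a @ x)); last exact: ca.
      by apply: (@near_eq_cvg _ _ (nbhs x)); near=> y; apply/esym/ga; near: y.
    have [L L0 [W Wx WL]] := La x.
    exists L => //; exists (U `&` W); first exact: filterI.
    by move=> y z [Uy Wy] [Uz Wz]; rewrite !ga//; exact: WL.
move=> _ [f Cf <-]; split=> x.
  apply: (@continuous_comp N _ R set_val f x); first exact: initial_continuous.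
  exact: Cinfty_continuous.
have [L L0 [U Ux UL]] := Cinfty_lipschitz (set_val x) Cf.
exists L => //; exists (set_val @^-1` U); last by move=> y z; exact: UL.
exact: (@initial_continuous N _ set_val x).
Unshelve. all: by end_near. Qed.

End lipschitz.

(** * Local coordinates on a subcartesian space *)

Section charts.
Context {R : realType} {M : topologicalType} (F : set (M -> R)).
Context (hF : differential_space F).

Lemma structure_continuous f : F f -> continuous f.
Proof.
move=> Ff; apply/continuousP => B oB; apply/hF.1.
exact: initial_open_preimage.
Qed.

(** The components of an embedding [phi] of a neighborhood of [p] agree, near
    [p], with members [a i] of [F]. The inverse of [phi] turns [f] into a
    function on the image of [phi] that is generated by smooth functions, hence
    locally Lipschitz. *)
Lemma local_coordinates p : subcartesian F ->
  exists n (a : 'I_n -> M -> R), [/\ forall i, F (a i),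
    exists2 V, nbhs p V & forall x y, V x -> V y -> (forall i, a i x = a i y) -> x = y &
    forall f, F f -> lipschitz_near (fun x => \row_i a i x : 'rV[R]_n) f p].
Proof.
move=> /(_ p) [U [oU Up [n [phi [smphi injphi [_ [psi [psiK _ smpsi]]]]]]]].
pose p' : U := exist _ p (mem_set Up).
have nU : nbhs p U by apply: open_nbhs_nbhs.
have coord i : exists2 a, F a & \forall y \near p', phi y ord0 i = a (set_val y).
  apply: (subspace_structure_local (ds_nonempty hF.2) (ds_comp hF.2)).
    exact: structure_continuous.
  by apply: (smphi (fun y => y ord0 i)); exact: Cinfty_coord.
pose a i := s2val (cid2 (coord i)).
have Fa i : F (a i) by rewrite /a; case: cid2.
have phia : \forall x \near p, forall z : U, set_val z = x -> phi z = \row_i a i x.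
  have : \forall z \near p', phi z = \row_i a i (set_val z).
    have : \forall z \near p', forall i, phi z ord0 i = a i (set_val z).
      apply: (@filter_forall _ _
        (fun i z => phi z ord0 i = a i (set_val z)) (nbhs p')) => i.
      by rewrite /a; case: cid2.
    by apply: filterS => z za; apply/rowP => i; rewrite mxE.
  by move=> /nbhs_set_type; apply: filterS => x H z zx; have := H z zx; rewrite zx.
pose V := U `&` [set x | forall z : U, set_val z = x -> phi z = \row_i a i x].
have Vp : nbhs p V by exact: filterI.
have lift x : V x -> exists2 z : U, set_val z = x & phi z = \row_i a i x.
  by move=> [Ux H]; exists (exist _ x (mem_set Ux)) => //; exact: H.
exists n, a; split=> //.
  exists V => // x y /lift[zx zxx phix] /lift[zy zyy phiy] axy.
  rewrite -zxx -zyy; congr set_val; apply: injphi.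
  by rewrite phix phiy; apply/rowP => i; rewrite !mxE.
move=> f Ff.
have SU : subspace_structure F U (fun x => f (\val x)).
  exact: subspace_structure_restriction.
have Sf := smpsi _ SU.
have [L L0 [W Wq WL]] := subspace_structure_lipschitz Sf (onto_image phi p').
have aW : \forall x \near p, forall z : range phi, set_val z = \row_i a i x -> W z.
  have : {for p, continuous (fun x => \row_i a i x : 'rV[R]_n)}.
    by apply: row_continuous_at => i; exact: structure_continuous.
  move=> ca; have [z zp phiz] := lift _ (nbhs_singleton Vp).
  have zp' : z = p' by exact: val_inj.
  have := nbhs_set_type Wq; rewrite [\val _](_ : _ = \row_i a i p) => [/ca//|].
  by rewrite -phiz zp'.
exists L => //.
exists (V `&` [set x | forall z : range phi, set_val z = \row_i a i x -> W z]).
  exact: filterI.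
move=> x y [/lift[zx zxx phix] Wx] [/lift[zy zyy phiy] Wy].
have := WL (onto_image phi zx) (onto_image phi zy)
  (Wx (onto_image phi zx) phix) (Wy (onto_image phi zy) phiy).
by rewrite /= !psiK [\val zx]zxx [\val zy]zyy -phix -phiy.
Qed.

(** Two points that [F] does not separate have the same neighborhoods, as the
    topology comes from [F]. They then lie in a common domain of local
    coordinates, and these coordinates separate points. *)
Lemma structure_separates x y : subcartesian F -> (forall f, F f -> f x = f y) -> x = y.
Proof.
move=> sub fxy; have [n [a [Fa [V Vx Vinj] _]]] := local_coordinates x sub.
apply: Vinj => [| |i]; [exact: nbhs_singleton | | exact: fxy].
move: Vx; rewrite nbhsE => -[W [/hF.1 oW Wx]]; apply.
have : [set W : set M | W x <-> W y] W; last by move=> /= WE; apply/WE.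
apply: initial_open_subset oW.
  split => // [A B /= Axy Bxy|G sG].
    by split=> -[/Axy ? /Bxy ?]; split.
  by split=> -[A GA Ax]; exists A => //; apply/(sG A GA).
by move=> f B Ff oB; rewrite /= /preimage/= fxy.
Qed.

End charts.

(** * Gronwall's inequality and derivatives relative to an interval *)

Section analysis.
Context {R : realType}.

(** Forward in time [u x * expR (- L * x)] is nonincreasing, backward
    [u x * expR (L * x)] is nondecreasing; both vanish at [s]. *)
Lemma gronwall_zero (u : R -> R) (L s t : R) :
  (forall x, derivable u x 1) -> (forall x, 0 <= u x) -> u s = 0 ->
  (forall x, (s <= x <= t) || (t <= x <= s) -> `|derive1 u x| <= L * u x) ->
  u t = 0.
Proof.
move=> du u0 us Lu.
have D (c x : R) : is_derive x (1 : R) (fun x => u x * expR (c * x))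
    ((derive1 u x + c * u x) * expR (c * x)).
  have De : is_derive x (1 : R) (fun x => expR (c * x)) (c * expR (c * x)).
    have Dc : is_derive x (1 : R) (fun x => c * x) c.
      have -> : (fun x => c * x) = (fun x : R => 0 + x * c).
        by apply/funext => y; rewrite add0r mulrC.
      by have := is_derive_affine 0 c x 1; rewrite mul1r.
    by rewrite mulrC; exact: (is_derive1_comp (is_derive_expR (c * x)) Dc).
  have Du : is_derive x (1 : R) u (derive1 u x) by rewrite derive1E; exact: DeriveDef.
  apply: (@is_derive_eq _ _ _ _ _ _ _ _ (is_deriveM Du De)).
  by rewrite /GRing.scale/=; ring.
have ch (c : R) : continuous (fun x => u x * expR (c * x)).
  move=> x; apply: differentiable_continuous; apply/derivable1_diffP.
  by have [] := D c x.
apply/eqP; rewrite eq_le u0 andbT.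
have [st|ts] := leP s t.
  suff : u t * expR (- L * t) <= 0 by rewrite pmulr_lle0// expR_gt0.
  have <- : u s * expR (- L * s) = 0 by rewrite us mul0r.
  apply: (@ler0_derive1_le_cc _ (fun x => u x * expR (- L * x)) s t) => //.
  - move=> x; rewrite in_itv/= => /andP[sx xt].
    rewrite derive1E; have [_ ->] := D (- L) x.
    rewrite pmulr_lle0 ?expR_gt0// mulNr subr_le0.
    by apply: (le_trans (ler_norm _)); apply: Lu; rewrite (ltW sx) (ltW xt).
  - exact: continuous_subspaceT.
  - by rewrite in_itv/= st lexx.
  - by rewrite in_itv/= st lexx.
suff : u t * expR (L * t) <= 0 by rewrite pmulr_lle0// expR_gt0.
have <- : u s * expR (L * s) = 0 by rewrite us mul0r.
apply: (@ger0_derive1_le_cc _ (fun x => u x * expR (L * x)) t s) => //.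
- move=> x; rewrite in_itv/= => /andP[sx xt]; rewrite derive1E; have [_ ->] := D L x.
  rewrite pmulr_lge0 ?expR_gt0// addrC -[X in _ + X]opprK subr_ge0.
  rewrite -[derive1 u x]opprK opprK; apply: (le_trans (ler_norm _)); rewrite normrN.
  by apply: Lu; rewrite (ltW sx) (ltW xt) orbT.
- exact: continuous_subspaceT.
- by rewrite in_itv/= (ltW ts) lexx.
- by rewrite in_itv/= (ltW ts) lexx.
- exact: ltW.
Qed.

Lemma sqr_norm_row_le n (u : 'rV[R]_n) : `|u| ^+ 2 <= \sum_i u ord0 i ^+ 2.
Proof.
have S0 : 0 <= \sum_i u ord0 i ^+ 2 by apply: sumr_ge0 => i _; exact: sqr_ge0.
rewrite -[leRHS]sqr_sqrtr// ler_sqr ?nnegrE ?sqrtr_ge0//.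
apply: norm_row_le => [|i]; first exact: sqrtr_ge0.
rewrite -sqrtr_sqr ler_sqrt//.
by rewrite (bigD1 i)//= lerDl sumr_ge0// => j _; exact: sqr_ge0.
Qed.

Lemma derivative_dnbhs (A : R -> R) (x : R) : derivable A x 1 ->
  (fun y => (A y - A x) / (y - x)) @ x^' --> derive1 A x.
Proof.
move=> dA.
have : (fun h => h^-1 *: (A (h + x) - A x)) @ (0 : R)^' --> derive1 A x.
  have quot : (fun h : R => h^-1 *: ((A \o shift x) h%:A - A x)) =
      (fun h => h^-1 *: (A (h + x) - A x)).
    by apply/funext => h; rewrite /= [h%:A]mulr1.
  by have := dA; rewrite /derivable quot.
move=> /cvgrPdist_lt H; apply/cvgrPdist_lt => e e0.
have /nbhs_ballP[d /= d0 dP] := H e e0.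
apply/nbhs_ballP; exists d => //= y; rewrite -ball_normE /= => xy yx.
have := dP (y - x); rewrite -ball_normE/= subrK mulrC; apply.
  by rewrite sub0r opprB.
by rewrite subr_eq0.
Qed.

End analysis.

Section derivative_in.
Context {R : realType} (J : set R).

Lemma set_val_dnbhs (t : J) : set_val @ t^' --> (set_val t)^'.
Proof.
move=> P /= tP.
have := @initial_continuous J _ set_val t _ tP.
rewrite /fmap /dnbhs /within /=; apply: (@filterS _ (nbhs t)) => s /= sP st.
by apply: sP; apply: contra_neq st; exact: val_inj.
Qed.

(** A point [t] of an interval that contains another point [z] is not isolated:
    there are points of the interval between [t] and [z]. *)
Lemma dnbhs_interval_proper (t : J) (z : R) :
  is_interval J -> J z -> z != set_val t -> ProperFilter t^'.
Proof.
move=> Ji Jz zt; split; last exact: dnbhs_filter.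
move=> /nbhs_set_type H.
have Jt : J (set_val t) := set_valP t.
have notJ y : J y -> y != set_val t -> ~ forall s : J, set_val s = y -> s != t -> False.
  move=> Jy yt /(_ (exist _ y (mem_set Jy)) erefl); apply.
  by apply: contra_neq yt => <-.
have [tz|zt'|/eqP] := ltgtP (set_val t) z; last by rewrite eq_sym (negPf zt).
- have : \forall y \near (set_val t)^'+, False; last by move=> /filter_ex[].
  near=> y; apply: (notJ y).
  + apply: (Ji _ _ Jt Jz); apply/andP; split; first exact: ltW.
    by near: y; exact: nbhs_right_le.
  + by rewrite gt_eqF.
  + by near: y; apply: cvg_within; exact: H.
- have : \forall y \near (set_val t)^'-, False; last by move=> /filter_ex[].
  near=> y; apply: (notJ y).
  + apply: (Ji _ _ Jz Jt); apply/andP; split; last exact: ltW.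
    by near: y; exact: nbhs_left_ge.
  + by rewrite lt_eqF.
  + by near: y; apply: cvg_within; exact: H.
Unshelve. all: by end_near. Qed.

Lemma has_derivative_in_restriction (h : J -> R) (A : R -> R) (t : J) :
  derivable A (set_val t) 1 ->
  (\forall y \near set_val t, forall s : J, set_val s = y -> h s = A y) ->
  has_derivative_in h t (derive1 A (set_val t)).
Proof.
move=> dA hA; have ht : h t = A (set_val t) := nbhs_singleton hA t erefl.
rewrite /has_derivative_in.
apply: (@cvg_trans _
    ((fun s : J => (A (set_val s) - A (set_val t)) / (set_val s - set_val t)) @ t^')).
  apply: (@near_eq_cvg _ _ t^'); apply: cvg_within.
  have := @initial_continuous J _ set_val t _ hA.
  by apply: (@filterS _ (nbhs t)) => s /= /(_ s erefl) ->; rewrite ht.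
apply: (@cvg_comp _ _ _ set_val
  (fun y => (A y - A (set_val t)) / (y - set_val t)) _ (set_val t)^').
  exact: set_val_dnbhs.
exact: derivative_dnbhs.
Qed.

Lemma has_derivative_in_unique (h : J -> R) (t : J) (z l l' : R) :
  is_interval J -> J z -> z != set_val t ->
  has_derivative_in h t l -> has_derivative_in h t l' -> l = l'.
Proof.
move=> Ji Jz zt hl hl'; have := dnbhs_interval_proper Ji Jz zt => PF.
exact: (@cvg_unique _ _ (fmap _ _) _ l l' hl hl').
Qed.

End derivative_in.

(** * Curves as graphs, and integral curves as local solutions *)

Section curves.
Context {R : realType} {M : topologicalType}.

(** Curves have different domain types; their graphs can be compared without
    transporting points from one domain to the other. *)
Definition passes (c : curve R M) (x : R) (q : M) : Prop :=
  exists2 t : dom c, set_val t = x & c t = q.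

Lemma passes_dom (c : curve R M) x q : passes c x q -> dom c x.
Proof. by move=> [t <- _]; exact: set_valP. Qed.

Lemma dom_passes (c : curve R M) x : dom c x -> exists q, passes c x q.
Proof.
move=> cx; pose t : dom c := exist _ x (mem_set cx).
by exists (c t), t.
Qed.

Lemma passes_fun (c : curve R M) x q q' : passes c x q -> passes c x q' -> q = q'.
Proof.
move=> [t tx <-] [t' t'x <-]; congr (c _); apply: val_inj.
exact: (etrans tx (esym t'x)).
Qed.

Lemma passes_point (c : curve R M) (t : dom c) : passes c (set_val t) (c t).
Proof. by exists t. Qed.

Lemma curve_ext (c c' : curve R M) :
  (forall x q, passes c x q <-> passes c' x q) -> c = c'.
Proof.
move=> E.
have domE : dom c = dom c'.
  apply/seteqP; split=> x /dom_passes[q]; first by move=> /E/passes_dom.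
  by move=> /E/passes_dom.
case: c c' domE E => J g [J' g'] /= JJ'; case: J' / JJ' g' => g' E.
congr Curve; apply/funext => t.
have [t' tt' /= <-] := (E _ _).1 (passes_point (c := Curve g) t).
by congr (g' _); exact/esym/val_inj.
Qed.

Lemma restricts_to_passes (c k : curve R M) :
  restricts_to c k <-> (forall x q, passes k x q -> passes c x q).
Proof.
split=> [[sub ck] x q [t <- <-]|kc].
  have ct : dom c (set_val t) by apply: sub; exact: set_valP.
  by exists (exist _ (set_val t) (mem_set ct)) => //; exact: ck.
split=> [x /dom_passes[q /kc/passes_dom]//|s t st].
apply: passes_fun (passes_point s) _; rewrite [set_val s]st.
exact/kc/passes_point.
Qed.

Context (F : set (M -> R)) (v : (M -> R) -> (M -> R)).

(** The local form of being an integral curve: near each time, the function [f]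
    along the curve extends to a smooth function [A] on a full neighborhood,
    even at an end of the domain, and [A] has derivative [v f]. A curve defined
    at a single time satisfies it too, with [A] affine. *)
Definition solution (c : curve R M) : Prop :=
  forall f, F f -> forall x, dom c x ->
    exists2 A : R -> R, Cinfty A &
      \forall y \near x, forall q, passes c y q -> f q = A y /\ derive1 A y = v f q.

Lemma Cinfty_R_nonempty : (@Cinfty R R) !=set0.
Proof. by exists (fun x => 0 + x * 0); exact: Cinfty_affine. Qed.

(** At a time that is not the only one of the domain, the derivative relative to
    the domain is unique, so it is the derivative of any smooth extension. *)
Lemma integral_curve_solution c : integral_curve F v c -> solution c.
Proof.
move=> [conn c0 cint] f Ff x cx.
have [triv|/existsNP[x' /not_implyP[cx' /eqP x'x]]] :=
    pselect (forall y, dom c y -> y = x).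
  have [q cq] := dom_passes cx.
  (* The affine function with value [f q] and slope [v f q] at [x]. *)
  exists (fun y => (f q - x * v f q) + y * v f q); first exact: Cinfty_affine.
  near=> y => q' cq'; rewrite derive1_affine.
  have yx := triv _ (passes_dom cq'); rewrite yx in cq' *.
  by rewrite (passes_fun cq' cq) subrK.
have Ji : is_interval (dom c) by apply/connected_intervalP.
case: cint => [[t ct]|[smc derc]].
  by move: cx cx' x'x; rewrite ct /= => -> ->; rewrite eqxx.
have [A CA cA] := subspace_structure_local Cinfty_R_nonempty
  (fun m g f Cg Cf => Cinfty_comp_row Cg Cf) (@Cinfty_continuous _ _)
  (smc _ Ff) (exist _ x (mem_set cx)).
exists A => //; have := nbhs_set_type cA => /= /nbhs_interior.
apply: filterS => y yA q [s sy <-]; split.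
  by rewrite -sy; apply: (interior_subset yA s sy).
have [z cz zs] : exists2 z, dom c z & z != set_val s.
  have [sx|sx] := eqVneq (set_val s) x; first by exists x' => //; rewrite sx.
  by exists x => //; rewrite eq_sym.
apply: (has_derivative_in_unique Ji cz zs); last exact: derc.
rewrite -sy; apply: has_derivative_in_restriction.
  exact: Cinfty_derivable.
by rewrite sy; apply: filterS yA => w H z' z'w; rewrite -z'w; exact: H z'w.
Unshelve. all: by end_near. Qed.

Lemma solution_integral_curve c : connected (dom c) -> dom c 0 ->
  solution c -> integral_curve F v c.
Proof.
move=> conn c0 sol; split=> //; right; split=> [f Ff|f Ff t].
  move=> S [dS subS]; apply: (ds_local dS) => t.
  have [A CA /nbhs_ballP[e /= e0 cA]] := sol f Ff _ (set_valP t).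
  exists (set_val @^-1` ball (set_val t) e); split.
  - apply: (@initial_open_preimage _ _ S set_val); last exact: ball_open.
    apply: subS; exists id => //.
    rewrite (_ : id = fun x : R => 0 + x * 1); first exact: Cinfty_affine.
    by apply/funext => x; rewrite add0r mulr1.
  - exact: ballxx.
  - exists (fun s => A (set_val s)); first by apply: subS; exists A.
    by move=> s /cA /(_ _ (passes_point s))[].
have [A CA cA] := sol f Ff _ (set_valP t).
have [_ <-] := nbhs_singleton cA _ (passes_point t).
apply: has_derivative_in_restriction; first exact: Cinfty_derivable.
by apply: filterS cA => y yA s sy; have [|] := yA (c s) => //; exists s.
Qed.

(** * Uniqueness of integral curves *)

Context (hF : differential_space F) (hsub : subcartesian F).
Context (vF : forall f, F f -> F (v f)).

Lemma solution_continuous c x q W : solution c -> passes c x q -> nbhs q W ->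
  \forall y \near x, forall q', passes c y q' -> W q'.
Proof.
move=> sol cxq; rewrite nbhsE => -[U [/hF.1 oU Uq] UW].
suff : [set U : set M | forall x q, passes c x q -> U q ->
    \forall y \near x, forall q', passes c y q' -> U q'] U.
  move=> /(_ _ _ cxq Uq); apply: filterS => y yU q' /yU; exact: UW.
apply: initial_open_subset oU.
  split=> [x' q' _ _|B C HB HC x' q' cq' [Bq Cq]|G sG x' q' cq' [B GB Bq]].
  - by near=> y.
  - apply: filterS2 (HB _ _ cq' Bq) (HC _ _ cq' Cq) => y yB yC r cr.
    by split; [exact: yB|exact: yC].
  - apply: filterS (sG _ GB _ _ cq' Bq) => y yB r cr.
    by exists B => //; exact: yB.
move=> f B Ff oB x' q' cq' Bq.
have [A CA cA] := sol f Ff _ (passes_dom cq').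
have [fA _] := nbhs_singleton cA _ cq'.
have AB : \forall y \near x', B (A y).
  have contA : continuous A by exact: Cinfty_continuous.
  apply: (contA x' B); apply: open_nbhs_nbhs; split=> //.
  by rewrite -fA.
by apply: filterS2 cA AB => y yA yB r /yA[]; rewrite /preimage /= => ->.
Unshelve. all: by end_near. Qed.

(** In local coordinates [a] around [q0], the squared distance [u] between the two
    curves satisfies [|u'| <= K u] because every [v (a i)] is a Lipschitz
    function of [a]. *)
Lemma solutions_agree_near c1 c2 x0 q0 :
  is_interval (dom c1) -> is_interval (dom c2) -> solution c1 -> solution c2 ->
  passes c1 x0 q0 -> passes c2 x0 q0 ->
  \forall x \near x0, forall q1 q2, passes c1 x q1 -> passes c2 x q2 -> q1 = q2.
Proof.
move=> I1 I2 sol1 sol2 c1q0 c2q0.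
have [n [a [Fa [V Vq0 Vinj] lip]]] := local_coordinates hF q0 hsub.
pose loc (c : curve R M) i (A : R -> R) := Cinfty A /\
  \forall y \near x0, forall q, passes c y q -> a i q = A y /\ derive1 A y = v (a i) q.
have coord c : solution c -> dom c x0 -> exists A, forall i, loc c i (A i).
  move=> sol cx0; have H i : exists A, loc c i A.
    by have [A] := sol _ (Fa i) _ cx0; exists A.
  by have [A HA] := choice H; exists A.
have [A Aloc] := coord _ sol1 (passes_dom c1q0).
have [B Bloc] := coord _ sol2 (passes_dom c2q0).
have /choice[L /= Lloc] : forall i, exists L : R, 0 <= L /\ exists2 U, nbhs q0 U &
    forall y z, U y -> U z -> `|v (a i) y - v (a i) z| <=
      L * `|(\row_j a j y : 'rV[R]_n) - \row_j a j z|.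
  by move=> i; have [L L0 LU] := lip _ (vF (Fa i)); exists L.
have /choice[U Uloc] : forall i, exists U, nbhs q0 U /\
    forall y z, U y -> U z -> `|v (a i) y - v (a i) z| <=
      L i * `|(\row_j a j y : 'rV[R]_n) - \row_j a j z|.
  by move=> i; have [_ [U]] := Lloc i; exists U.
have L0 i : 0 <= L i by have [] := Lloc i.
pose W := V `&` [set q | forall i, U i q].
have Wq0 : nbhs q0 W.
  apply: filterI => //; apply: (@filter_forall _ _ U (nbhs q0)) => i.
  by have [] := Uloc i.
have good c A' : solution c -> passes c x0 q0 -> (forall i, loc c i (A' i)) ->
    \forall y \near x0, forall q, passes c y q ->
      W q /\ forall i, a i q = A' i y /\ derive1 (A' i) y = v (a i) q.
  move=> sol cq0 A'loc.
  have : \forall y \near x0, forall i, forall q, passes c y q ->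
      a i q = A' i y /\ derive1 (A' i) y = v (a i) q.
    apply: (@filter_forall _ _ (fun i y => forall q, passes c y q ->
      a i q = A' i y /\ derive1 (A' i) y = v (a i) q) (nbhs x0)) => i.
    by have [] := A'loc i.
  apply: filterS2 (solution_continuous sol cq0 Wq0) => y yW yA q cq; split.
    exact: yW.
  by move=> i; exact: yA.
have H12 := @filterI _ (nbhs x0) _ _ _
  (good _ _ sol1 c1q0 Aloc) (good _ _ sol2 c2q0 Bloc).
have [e /= e0 He] := (nbhs_ballP x0 _).1 (H12 _).
apply/(nbhs_ballP x0); exists e => // x x0x q1 q2 c1q1 c2q2.
pose u y : R := \sum_i (A i y - B i y) ^+ 2.
pose K := 2 * \sum_i L i.
have Du y : is_derive y (1 : R) u
    (\sum_i 2 * (A i y - B i y) * (derive1 (A i) y - derive1 (B i) y)).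
  have -> : u = \sum_i (fun y => (A i y - B i y) ^+ 2).
    by apply/funext => z; rewrite fct_sumE.
  apply: is_derive_sum => i.
  have DA : is_derive y (1 : R) (A i) (derive1 (A i) y).
    rewrite derive1E; apply: DeriveDef => //.
    by apply: Cinfty_derivable; have [] := Aloc i.
  have DB : is_derive y (1 : R) (B i) (derive1 (B i) y).
    rewrite derive1E; apply: DeriveDef => //.
    by apply: Cinfty_derivable; have [] := Bloc i.
  have DAB := is_deriveB DA DB.
  have := is_deriveM DAB DAB.
  have -> : (A i - B i) * (A i - B i) = (fun y => (A i y - B i y) ^+ 2).
    by apply/funext => z; rewrite expr2.
  move=> DD; apply: (@is_derive_eq _ _ _ _ _ _ _ _ DD).
  by rewrite /GRing.scale/= [(A i - B i) y](_ : _ = A i y - B i y)//; ring.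
have ux : u x = 0.
  apply: (@gronwall_zero _ u K x0 x).
  - by move=> y; have [] := Du y.
  - by move=> y; apply: sumr_ge0 => i _; exact: sqr_ge0.
  - have [He1 He2] := He x0 (ballxx _ e0).
    have [[_ HA] [_ HB]] := (He1 _ c1q0, He2 _ c2q0).
    by apply: big1 => i _; rewrite -(HA i).1 -(HB i).1 subrr expr0n.
  move=> y xyx0.
  have yball : ball x0 e y.
    move: x0x; rewrite -ball_normE /ball_ /=.
    move: xyx0 => /orP[] /andP[h1 h2].
      by rewrite !ler0_norm ?subr_le0 ?(le_trans h1)// => ?; lra.
    by rewrite !ger0_norm ?subr_ge0 ?(le_trans h1)// => ?; lra.
  have doms (c : curve R M) : is_interval (dom c) -> dom c x0 -> dom c x -> dom c y.
    by move=> I cx0 cx; case/orP: xyx0 => xyx0; [exact: (I x0 x)|exact: (I x x0)].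
  have [r1 c1r1] := dom_passes (doms _ I1 (passes_dom c1q0) (passes_dom c1q1)).
  have [r2 c2r2] := dom_passes (doms _ I2 (passes_dom c2q0) (passes_dom c2q2)).
  have [[[_ U1] HA] [[_ U2] HB]] := ((He y yball).1 _ c1r1, (He y yball).2 _ c2r2).
  pose d : 'rV[R]_n := \row_j a j r1 - \row_j a j r2.
  have dE i : d ord0 i = A i y - B i y by rewrite !mxE (HA i).1 (HB i).1.
  rewrite derive1E; have [_ ->] := Du y.
  apply: (@le_trans _ _ (\sum_i 2 * L i * `|d| ^+ 2)).
    apply: (le_trans (ler_norm_sum _ _ _)); apply: ler_sum => i _.
    rewrite !normrM (HA i).2 (HB i).2 -dE expr2 [`|2|]ger0_norm//.
    rewrite -2!mulrA ler_wpM2l// mulrCA ler_pM//.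
      exact: norm_coord_le.
    by have [_] := Uloc i; apply.
  rewrite -mulr_suml -mulr_sumr ler_wpM2l//.
    by rewrite mulr_ge0// sumr_ge0.
  apply: (le_trans (sqr_norm_row_le d)); rewrite le_eqVlt; apply/orP; left.
  by apply/eqP/eq_bigr => i _; rewrite dE.
have [[[V1 _] HA] [[V2 _] HB]] := ((He x x0x).1 _ c1q1, (He x x0x).2 _ c2q2).
apply: Vinj => // i; rewrite (HA i).1 (HB i).1; apply/eqP; rewrite -subr_eq0 -sqrf_eq0.
have := ux; rewrite /u => /eqP.
rewrite psumr_eq0 => [/allP/(_ i)|j _]; last exact: sqr_ge0.
by apply; rewrite mem_index_enum.
Qed.

(** The set [E] of times where the curves coincide is open in the common domain by
    [solutions_agree_near]. A limit of [E] in the common domain belongs to [E]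
    because [F] separates points and its members are continuous along the
    curves. *)
Lemma solutions_agree c1 c2 x0 q0 : solution c1 -> solution c2 ->
  is_interval (dom c1) -> is_interval (dom c2) ->
  passes c1 x0 q0 -> passes c2 x0 q0 ->
  forall x q1 q2, passes c1 x q1 -> passes c2 x q2 -> q1 = q2.
Proof.
move=> sol1 sol2 I1 I2 c1q0 c2q0 x q1 q2 c1q1 c2q2.
pose J := dom c1 `&` dom c2.
have connJ : connected J.
  apply/connected_intervalP => y z [y1 y2] [z1 z2] t yz.
  by split; [exact: (I1 y z) | exact: (I2 y z)].
pose E := [set y | exists2 q, passes c1 y q & passes c2 y q].
have EJ : E `<=` J by move=> y [q /passes_dom ? /passes_dom ?].
suff EJ' : E = J.
  have : J x by split; [exact: passes_dom c1q1|exact: passes_dom c2q2].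
  rewrite -EJ' => -[q c1q c2q].
  by rewrite (passes_fun c1q1 c1q) (passes_fun c2q2 c2q).
apply: connJ; first by exists x0, q0.
- exists (interior [set y | J y -> E y]); first exact: open_interior.
  apply/seteqP; split=> y; last by move=> [Jy /interior_subset]; apply.
  move=> Ey; split; first exact: EJ.
  have [q c1q c2q] := Ey.
  have := solutions_agree_near I1 I2 sol1 sol2 c1q c2q.
  rewrite /interior/=.
  apply: filterS => z agree [/dom_passes[r1 c1r1] /dom_passes[r2 c2r2]].
  by exists r1 => //; rewrite (agree _ _ c1r1 c2r2).
exists (closure E); first exact: closed_closure.
apply/seteqP; split=> y; first by move=> Ey; split; [exact: EJ|exact: subset_closure].
move=> [[/dom_passes[r1 c1r1] /dom_passes[r2 c2r2]] clEy].
suff r12 : r1 = r2 by exists r1; rewrite // r12.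
apply: (structure_separates hF hsub) => f Ff.
have [A CA cA] := sol1 _ Ff _ (passes_dom c1r1).
have [B CB cB] := sol2 _ Ff _ (passes_dom c2r2).
rewrite (nbhs_singleton cA _ c1r1).1 (nbhs_singleton cB _ c2r2).1.
apply/eqP; rewrite -subr_eq0; apply/negP => /negP AB.
have contAB : continuous (A - B).
  have contA := Cinfty_continuous CA; have contB := Cinfty_continuous CB.
  by move=> z; apply: cvgB; [exact: contA|exact: contB].
have ABy : \forall z \near y, (A - B) z != 0.
  apply: (contAB y [set w | w != 0]); apply: open_nbhs_nbhs.
  by split; first exact: open_neq.
have [z [[q c1q c2q]]] := clEy _ (filterI ABy (filterI cA cB)).
move=> [/= /eqP + [zA zB]]; apply.
by rewrite -[(A - B) z]/(A z - B z) -(zA _ c1q).1 -(zB _ c2q).1 subrr.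
Qed.

(** * Derivatives of all orders at time 0 *)

Lemma within_open_near (D : set R) (x : R) (P : set R) : open D ->
  (\forall y \near within D (nbhs x), P y) ->
  \forall y \near within D (nbhs x), nbhs y P.
Proof.
move=> oD /nbhs_interior; apply: filterS => y yP Dy.
have yD : nbhs y D by apply: open_nbhs_nbhs.
by apply: filterS2 yP yD => z; apply.
Qed.

Lemma Cinfty_eq_within (D : set R) (A B : R -> R) : open D ->
  ProperFilter (within D (nbhs (0 : R))) -> Cinfty A -> Cinfty B ->
  (\forall y \near within D (nbhs (0 : R)), A y = B y) ->
  A 0 = B 0 /\ \forall y \near within D (nbhs (0 : R)), derive1 A y = derive1 B y.
Proof.
move=> oD PF CA CB AB; split; last first.
  have := within_open_near oD AB; apply: filterS => y yAB.
  by rewrite !derive1E; apply: near_eq_derive.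
have G0 : within D (nbhs (0 : R)) --> (0 : R) by exact: cvg_within.
have lA := cvg_trans (cvg_app A G0) (Cinfty_continuous CA (x:=0)).
have lB := cvg_trans (cvg_app B G0) (Cinfty_continuous CB (x:=0)).
have lBA : A @ within D (nbhs (0 : R)) --> B 0.
  by apply: cvg_trans lB; apply: near_eq_cvg; apply: filterS AB => y ->.
exact: (@cvg_unique _ _ (fmap A _) _ _ _ lA lBA).
Qed.

(** Differentiating [f] along a solution gives [v f], so by induction the [n]-th
    derivative at 0 is [(v^n f) p]. The open set [D] stands for one side of 0,
    on which the curve [c] is defined; this one side determines all the
    derivatives of [A] at 0. *)
Lemma solution_jets (D : set R) c p : open D ->
  ProperFilter (within D (nbhs (0 : R))) ->
  (\forall y \near within D (nbhs (0 : R)), dom c y) ->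
  solution c -> passes c 0 p ->
  forall n f A, F f -> Cinfty A ->
    (\forall y \near (0 : R), forall q, passes c y q -> f q = A y) ->
    derive1n n A 0 = iter n v f p.
Proof.
move=> oD PF Dc sol cp.
have extension f A : F f -> Cinfty A ->
    (\forall y \near within D (nbhs (0 : R)), forall q, passes c y q -> f q = A y) ->
    A 0 = f p /\ \forall y \near within D (nbhs (0 : R)),
      forall q, passes c y q -> v f q = derive1 A y.
  move=> Ff CA fA; have [B CB cB] := sol _ Ff _ (passes_dom cp).
  have DB : \forall y \near within D (nbhs (0 : R)),
      forall q, passes c y q -> f q = B y /\ derive1 B y = v f q.
    by apply: cvg_within.
  have AB : \forall y \near within D (nbhs (0 : R)), A y = B y.
    apply: filterS3 Dc fA DB => y /dom_passes[q cq] yA yB.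
    by rewrite -(yA _ cq) (yB _ cq).1.
  have [-> AB'] := Cinfty_eq_within oD PF CA CB AB.
  rewrite (nbhs_singleton cB _ cp).1; split=> //.
  by apply: filterS2 AB' DB => y yAB yB q /yB[_ <-]; rewrite yAB.
suff jets n : forall f A, F f -> Cinfty A ->
    (\forall y \near within D (nbhs (0 : R)), forall q, passes c y q -> f q = A y) ->
    derive1n n A 0 = iter n v f p.
  by move=> n f A Ff CA fA; apply: jets => //; apply: cvg_within.
elim: n => [|n IH] f A Ff CA fA; have [A0 vfA] := extension f A Ff CA fA; first by [].
by rewrite derive1Sn iterSr; apply: IH => //; [exact: vF | exact: Cinfty_derive1].
Qed.

(** * The union of the integral curves through a point *)

Section union.
Variable p : M.

Definition through (k : curve R M) := integral_curve F v k /\ starts_at k p.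

Lemma through_solution k : through k ->
  [/\ solution k, is_interval (dom k) & passes k 0 p].
Proof.
move=> [ik kp]; split=> //; first exact: integral_curve_solution.
by apply/connected_intervalP; case: ik.
Qed.

Lemma through_agree k k' x q q' : through k -> through k' ->
  passes k x q -> passes k' x q' -> q = q'.
Proof.
move=> /through_solution[s1 i1 p1] /through_solution[s2 i2 p2].
exact: (solutions_agree s1 s2 i1 i2 p1 p2).
Qed.

Lemma through_constant : through (Curve (fun _ : [set 0 : R] => p)).
Proof.
split; last by exists (exist _ 0 (mem_set (erefl (0 : R)))).
split=> //; first exact: connected1.
by left; exists 0.
Qed.

Lemma union_exists (t : [set x | exists2 k, through k & dom k x]) :
  exists q, exists2 k, through k & passes k (set_val t) q.
Proof. by have [k tk /dom_passes[q kq]] := set_valP t; exists q, k. Qed.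

Definition union_curve : curve R M :=
  Curve (fun t : [set x | exists2 k, through k & dom k x] =>
    sval (cid (union_exists t))).

Lemma union_passes x q :
  passes union_curve x q <-> exists2 k, through k & passes k x q.
Proof.
split=> [[t <- <-]|[k tk kq]]; first by rewrite /=; case: cid.
have Ux : dom union_curve x by exists k => //; exact: passes_dom kq.
exists (exist _ x (mem_set Ux)) => //=; case: cid => q' /= [k' tk' k'q'].
exact: through_agree k'q' kq.
Qed.

Lemma union_dom_interval : is_interval (dom union_curve).
Proof.
move=> x y [k1 t1 k1x] [k2 t2 k2y] z /andP[xz zy].
have [z0|z0] := leP 0 z.
  exists k2 => //; have [_ I /passes_dom k0] := through_solution t2.
  by apply: (I 0 y) => //; rewrite z0.
exists k1 => //; have [_ I /passes_dom k0] := through_solution t1.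
by apply: (I x 0) => //; rewrite xz ltW.
Qed.

Lemma through_dom_between k s t y : through k -> dom k s -> dom k t ->
  s <= y <= t -> dom k y.
Proof. by move=> /through_solution[_ I _] ks kt; exact: (I s t). Qed.

(** All the domains are intervals that contain 0. For [x > 0], a curve of the
    family that reaches beyond [x], or that reaches [x] when [x] is the last
    time of the union, is defined on all the times of the union near [x]; symmetrically
    for [x < 0]. For [x = 0] this works as well, unless the union contains both
    positive and negative times. *)
Lemma union_locally_covered x : dom union_curve x ->
  (exists2 k, through k &
      dom k x /\ \forall y \near x, dom union_curve y -> dom k y) \/
  [/\ x = 0, exists2 k, through k & exists2 s, 0 < s & dom k s &
      exists2 k, through k & exists2 s, s < 0 & dom k s].
Proof.
move=> [k0 t0 k0x].
have dom0 k : through k -> dom k 0 by move=> /through_solution[_ _ /passes_dom].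
pose right := exists2 k, through k & exists2 s, x < s & dom k s.
pose left := exists2 k, through k & exists2 s, s < x & dom k s.
have rightN : ~ right -> forall y, dom union_curve y -> y <= x.
  move=> nR y [k tk ky]; rewrite leNgt; apply/negP => xy; apply: nR.
  by exists k => //; exists y.
have leftN : ~ left -> forall y, dom union_curve y -> x <= y.
  move=> nL y [k tk ky]; rewrite leNgt; apply/negP => yx; apply: nL.
  by exists k => //; exists y.
have up : exists2 k, through k & exists2 t, dom k t /\ x <= t &
    \forall y \near x, dom union_curve y -> y <= t.
  have [[k tk [t xt kt]]|/rightN nR] := pselect right.
    exists k => //; exists t; first by split=> //; exact: ltW.
    by near=> y => _; apply: ltW; near: y; exact: lt_nbhsl.
  by exists k0 => //; exists x => //; near=> y; exact: nR.
have down : exists2 k, through k & exists2 s, dom k s /\ s <= x &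
    \forall y \near x, dom union_curve y -> s <= y.
  have [[k tk [s sx ks]]|/leftN nL] := pselect left.
    exists k => //; exists s; first by split=> //; exact: ltW.
    by near=> y => _; apply: ltW; near: y; exact: lt_nbhsr.
  by exists k0 => //; exists x => //; near=> y; exact: nL.
have nonneg : 0 <= x -> (\forall y \near x, dom union_curve y -> 0 <= y) ->
    exists2 k, through k &
      dom k x /\ \forall y \near x, dom union_curve y -> dom k y.
  move=> x0 y0; have [k tk [t [kt xt] yt]] := up; exists k => //; split.
    by apply: (through_dom_between tk (dom0 _ tk) kt); rewrite x0.
  apply: filterS2 y0 yt => y y0 yt Uy.
  by apply: (through_dom_between tk (dom0 _ tk) kt); rewrite y0//= yt.
have nonpos : x <= 0 -> (\forall y \near x, dom union_curve y -> y <= 0) ->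
    exists2 k, through k &
      dom k x /\ \forall y \near x, dom union_curve y -> dom k y.
  move=> x0 y0; have [k tk [s [ks sx] sy]] := down; exists k => //; split.
    by apply: (through_dom_between tk ks (dom0 _ tk)); rewrite sx.
  apply: filterS2 y0 sy => y y0 sy Uy.
  by apply: (through_dom_between tk ks (dom0 _ tk)); rewrite y0// sy.
have [x0|x0|x0] := ltgtP x 0.
- left; apply: nonpos; first exact: ltW.
  by near=> y => _; apply: ltW; near: y; exact: lt_nbhsl.
- left; apply: nonneg; first exact: ltW.
  by near=> y => _; apply: ltW; near: y; exact: lt_nbhsr.
- have [L_|/leftN nL] := pselect left; last first.
    by left; apply: nonneg; [rewrite x0|near=> y; rewrite -x0; exact: nL].
  have [R_|/rightN nR] := pselect right; last first.
    by left; apply: nonpos; [rewrite x0|near=> y; rewrite -x0; exact: nR].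
  by right; move: L_ R_; rewrite /left /right x0.
Unshelve. all: by end_near. Qed.

Lemma union_solution : solution union_curve.
Proof.
move=> f Ff x /[dup] Ux /union_locally_covered[[k tk [kx Uk]]|].
  have [solk _ _] := through_solution tk.
  have [A CA kA] := solk _ Ff _ kx; exists A => //.
  apply: filterS2 kA Uk => y yA Uky q Uq.
  have /dom_passes[q' kq'] := Uky (passes_dom Uq).
  have [k' tk' k'q] := (union_passes _ _).1 Uq.
  by rewrite (through_agree tk' tk k'q kq'); exact: yA.
move=> [-> [k1 t1 [s1 s1_gt0 k1s1]] [k2 t2 [s2 s2_lt0 k2s2]]].
have [sol1 I1 k1p] := through_solution t1; have [sol2 I2 k2p] := through_solution t2.
have [A CA kA] := sol1 _ Ff _ (passes_dom k1p).
have [B CB kB] := sol2 _ Ff _ (passes_dom k2p).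
have near1 : \forall y \near (0 : R), 0 <= y -> dom k1 y.
  near=> y => y0; apply: (I1 0 s1) => //; first exact: passes_dom k1p.
  by rewrite y0 /=; near: y; exact: lt_le_nbhsl.
have near2 : \forall y \near (0 : R), y <= 0 -> dom k2 y.
  near=> y => y0; apply: (I2 s2 0) => //; first exact: passes_dom k2p.
  by rewrite y0 andbT; near: y; exact: lt_le_nbhsr.
have jetA n : derive1n n A 0 = iter n v f p.
  apply: (solution_jets (open_gt (y := 0)) (at_right_proper_filter 0) _ sol1 k1p) => //.
    by apply: filterS near1 => y yk1 /ltW.
  by apply: filterS kA => y yA q /yA[].
have jetB n : derive1n n B 0 = iter n v f p.
  apply: (solution_jets (open_lt (y := 0)) (at_left_proper_filter 0) _ sol2 k2p) => //.
    by apply: filterS near2 => y yk2 /ltW.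
  by apply: filterS kB => y yB q /yB[].
have jets n : derive1n n A 0 = derive1n n B 0 by rewrite jetA jetB.
exists (glue A B); first exact: glue_Cinfty.
near=> y => q Uq.
have Dg : derive1 (glue A B) y = glue (derive1 A) (derive1 B) y.
  rewrite derive1E.
  by have [] := is_derive_glue (Cinfty_derivable CA) (Cinfty_derivable CB)
    (jets 0%N) (jets 1%N) y.
have [k tk kq] := (union_passes _ _).1 Uq.
(* The curve [k] through [q] agrees with [k1] after time 0, with [k2] before. *)
rewrite Dg /glue; case: leP => y0.
  have /dom_passes[q' k1q'] : dom k1 y by move: y0; near: y; exact: near1.
  rewrite (through_agree tk t1 kq k1q').
  by move: (q') k1q'; near: y; exact: kA.
have /dom_passes[q' k2q'] : dom k2 y by move/ltW: y0; near: y; exact: near2.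
rewrite (through_agree tk t2 kq k2q').
by move: (q') k2q'; near: y; exact: kB.
Unshelve. all: by end_near. Qed.

Lemma union_through : through union_curve.
Proof.
have U0 : passes union_curve 0 p.
  apply/union_passes; eexists; first exact: through_constant.
  by exists (exist _ 0 (mem_set (erefl (0 : R)))).
split=> //; apply: solution_integral_curve; last exact: union_solution.
  by apply/connected_intervalP; exact: union_dom_interval.
exact: passes_dom U0.
Qed.

Lemma union_maximal : maximal_integral_curve F v union_curve.
Proof.
have [iU Up] := union_through; split=> // k ik [p' Up' kp'].
apply/restricts_to_passes => x q kq; apply/union_passes; exists k => //; split=> //.
by rewrite /starts_at; rewrite (passes_fun Up Up').
Qed.

End union.

End curves.

Theorem corollary3p22 (R : realType) (M : topologicalType) (F : set (M -> R))
    (hF : differential_space F)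
    (hsc : @second_countable M)
    (hsub : subcartesian F)
    (hdim : (structural_dimension F < +oo)%E)
    (v : (M -> R) -> (M -> R)) (hv : derivation F v) (p : M) :
  exists! c : curve R M, maximal_integral_curve F v c /\ starts_at c p.
Proof.
have vF f : F f -> F (v f) by move=> Ff; exact: (der_in hv Ff).
have [iU Up] := union_through hF hsub vF p.
have maxU := union_maximal hF hsub vF p.
exists (union_curve F v p); split=> // c [[ic maxc] cp].
have rc : restricts_to c (union_curve F v p) by apply: maxc => //; exists p.
have ru : restricts_to (union_curve F v p) c by apply: maxU.2 => //; exists p.
by apply: curve_ext => x q; split; [exact/(restricts_to_passes c _).1|
  exact/(restricts_to_passes _ c).1].
Qed.
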